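(* For every natural number $s \geq 3$ there exists a constant $c_s$ such that for every natural number $n$, \[ r(Q_n, K_s) \leq c_s\, 2^n. \]
   Context: The hypercube $Q_n$ is the graph on vertex set $\{0,1\}^n$ in which two vertices are adjacent if and only if they differ in exactly one coordinate. For graphs $G,H$, the Ramsey number $r(G,H)$ is the smallest natural number $N$ such that every red/blue coloring of the edges of the complete graph $K_N$ contains a red copy of $G$ or a blue copy of $H$. $K_s$ is the complete graph on $s$ vertices. (Equivalently, $r(Q_n,K_s)$ is the least $N$ such that every graph on $N$ vertices contains $Q_n$ as a subgraph or has an independent set of size $s$.) *)

(* Defs.v *)
From mathcomp Require Import all_boot.
Set Implicit Arguments. Unset Strict Implicit. Unset Printing Implicit Defensive.

Definition cube_vert (n : nat) : finType := {ffun 'I_n -> bool}.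
Arguments cube_vert : clear implicits.
Definition cube_adj (n : nat) : rel (cube_vert n) :=
  fun u v => #|[set i : 'I_n | u i != v i]| == 1.

Definition complete_adj (s : nat) : rel 'I_s := fun i j => i != j.

Definition contains_copy (T U : finType) (H : rel T) (e : rel U) : Prop :=
  exists f : T -> U, injective f /\ forall x y, H x y -> e (f x) (f y).

(* Every red/blue colouring of the edges of K_N contains a red copy of G or a
   blue copy of H.  A colouring is a symmetric relation [red] on 'I_N: the edge
   {x,y} (x <> y) is red iff [red x y], blue otherwise (the diagonal is
   irrelevant since copies are injective and graphs are loopless). *)
Definition ramsey_prop (T1 T2 : finType) (G : rel T1) (H : rel T2) (N : nat)
  : Prop :=
  forall red : rel 'I_N, symmetric red ->
    contains_copy G red \/ contains_copy H (fun x y => ~~ red x y).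

Definition is_ramsey_number (T1 T2 : finType) (G : rel T1) (H : rel T2)
  (r : nat) : Prop :=
  ramsey_prop G H r /\ forall N, ramsey_prop G H N -> r <= N.
Arguments cube_adj n : clear implicits.
Arguments complete_adj s : clear implicits.

(* Main.v *)
From Stdlib Require Import Classical.
Require Import Defs.
From mathcomp Require Import all_boot all_order all_algebra.
From mathcomp Require Import zify ring lra.
Import Order.TTheory GRing.Theory Num.Theory.
Set Implicit Arguments. Unset Strict Implicit. Unset Printing Implicit Defensive.

(** The blue graph is K_s-free on capacity(s) 2^n vertices, and every blue
    neighbourhood in a K_(u+1)-free set is K_u-free.  Hence a K_(u+1)-free set of
    size about 2^m splits, up to a bounded remainder, into K_u-free pieces of sizes
    about 2^(m-f), cut greedily by decreasing size, so that a vertex of a piece of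
    scale f sends at most about 2^(m-f) blue edges to the pieces cut later.
    Iterating gives a tree of sets ending in single vertices.

    Subcubes of Q_n obtained by fixing the first e coordinates are assigned to
    nodes of size about 2^(n-e), for e = 0, ..., n, as long as possible, so that
    the nodes currently holding two adjacent cube vertices (if neither contains
    the other) have small blue density.  The admissible density depends on the
    flipped coordinate i, relative to the scale of the smallest node containing
    both; it is loosened slightly at each refinement.  For a fixed cube vertex x
    every i gives only one neighbour, so the forbidden pieces have total mass
    bounded by a geometric series.  Therefore no x stays unassigned, and each x
    finally gets a single vertex, where density below 1 means density 0. *)

(** * Disjoint sums, list suffixes and elementary inequalities *)

Lemma sum_disjoint (I X : finType) (P : pred I) (T : I -> {set X}) (A : {set X})
    (w : X -> nat) :
  (forall i, P i -> T i \subset A) ->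
  (forall i j, P i -> P j -> i != j -> [disjoint T i & T j]) ->
  \sum_(i | P i) \sum_(a in T i) w a <= \sum_(a in A) w a.
Proof.
move=> TA dT; under eq_bigr => i Pi do rewrite big_mkcond.
rewrite exchange_big [leqRHS]big_mkcond; apply: leq_sum => a _ /=.
rewrite -big_mkcondr /=.
case: (pickP (fun i => P i && (a \in T i))) => [i /andP[Pi ai]|no]; last first.
  by rewrite big_pred0.
rewrite (bigD1 i) ?Pi //= [X in _ + X]big1 ?addn0; last first.
  move=> j /andP[/andP[Pj aj] ij]; have := dT j i Pj Pi ij.
  by rewrite disjoints_subset => /subsetP/(_ a aj); rewrite inE ai.
by rewrite (subsetP (TA i Pi)).
Qed.

Lemma suffix_antisym (T : eqType) (p q : seq T) : suffix p q -> suffix q p -> p = q.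
Proof.
move=> /suffixP[r ->] /size_suffix; rewrite size_cat.
by case: r => //= c r; rewrite addSn ltnNge leq_addl.
Qed.

Lemma suffix_consE (T : eqType) (p q : seq T) c : suffix q (c :: p) = (q == c :: p) || suffix q p.
Proof.
apply/idP/orP.
  case/suffixP=> -[|d r] /= e; first by left; rewrite e eqxx.
  by case: e => _ ->; right; apply: suffix_suffix.
case=> [/eqP->|/suffixP[r ->]]; first exact: suffix_refl.
by rewrite -cat_cons; apply: suffix_suffix.
Qed.

(** Nodes will be lists with the deepest entry first, so a suffix is an ancestor, and two ancestors
    of one node are comparable. *)
Lemma suffix_total (T : eqType) (p q r : seq T) : suffix p r -> suffix q r -> size p <= size q -> suffix p q.
Proof.
move=> /suffixP[a ->]; elim: a => [|c a IH] /=.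
  rewrite [suffix q p]suffixE => + pq; have -> : size p - size q = 0 by lia.
  by rewrite drop0 => /eqP->; apply: suffix_refl.
rewrite suffix_consE => /orP[/eqP-> _|]; last exact: IH.
by rewrite -cat_cons; apply: suffix_suffix.
Qed.

Lemma geometric_sum (x : rat) (a N : nat) : (0 <= x)%R -> (x < 1)%R ->
  (\sum_(i < N | (a <= i)%N) x ^+ (i - a)%N <= (1 - x)^-1)%R.
Proof.
move=> x0 x1; have y0 : (0 < 1 - x)%R by rewrite subr_gt0.
suff -> : (\sum_(i < N | (a <= i)%N) x ^+ (i - a)%N = (1 - x ^+ (N - a)%N) / (1 - x))%R.
  by rewrite ler_pdivrMr // mulVf ?gt_eqF // gerBl exprn_ge0.
elim: N => [|N IH]; first by rewrite big_ord0 sub0n expr0 subrr mul0r.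
rewrite big_mkcond big_ord_recr /= -big_mkcond /= IH; case: leqP => aN.
  by rewrite subSn // exprS; field; rewrite gt_eqF.
have -> : (N - a)%N = 0%N by lia.
by rewrite (_ : (N.+1 - a)%N = 0%N) ?addr0 //; lia.
Qed.

Lemma geometric_sum_two_thirds (a N : nat) :
  (\sum_(i < N | (a <= i)%N) (2 / 3) ^+ (i - a)%N <= 3 :> rat)%R.
Proof.
have q0 : (0 <= 2 / 3 :> rat)%R by lra.
have q1 : (2 / 3 < 1 :> rat)%R by lra.
apply: le_trans (geometric_sum a N q0 q1) _.
by rewrite le_eqVlt; apply/orP; left; apply/eqP; field.
Qed.

(** Closing arithmetic of [not_stuck]: a is the size of the set, b the leftover, c the used mass, d
    the inner mass; the outer mass costs an eighth of a. *)
Lemma budget (a b c d : rat) :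
  (b + (c + d) <= 7 / 8 * a)%R -> (c + (d + 8^-1 * a) + b <= a)%R.
Proof. by lra. Qed.

Lemma bernoulli (x : rat) h : (0 <= x)%R -> (x <= 1)%R -> (1 - h%:R * x <= (1 - x) ^+ h)%R.
Proof.
move=> x0 x1; elim: h => [|h IH]; first by rewrite mul0r subr0.
rewrite exprS; apply: le_trans (ler_wpM2l _ IH); last by rewrite subr_ge0.
have : (0 <= h%:R * (x * x))%R by rewrite !mulr_ge0.
by rewrite -natr1; lra.
Qed.

(** Fits the recursion of [capacity]: as c >= 1, both terms on the left are at most (1 + 3y) c^2,
    and the factor 4 leaves room to give up an eighth. *)
Lemma quadratic_growth (y c : rat) : (1 <= c)%R -> (0 <= y)%R ->
  (c * c + c * (1 + 3 * y) <= 7 / 8 * (4 * (1 + 3 * y) * (c * c)))%R.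
Proof.
move=> c1 y0; have c0 : (0 <= c)%R := le_trans ler01 c1.
have cc : (c <= c * c)%R by rewrite ler_peMr.
have := ler_wpM2r y0 cc; have := mulr_ge0 (mulr_ge0 c0 c0) y0.
by move: cc; lra.
Qed.

(** * Subcubes *)

Section Cube.

Variable n : nat.
Local Notation Q := (cube_vert n).
Implicit Types (x y z : Q) (i : 'I_n).

Definition agree e x y := [forall k : 'I_n, (k < e) ==> (x k == y k)].

Lemma agreeP e x y : reflect (forall k : 'I_n, k < e -> x k = y k) (agree e x y).
Proof.
apply: (iffP forallP) => H k; first by move=> ke; apply/eqP; have := H k; rewrite ke.
by apply/implyP=> /H->.
Qed.

Lemma agree_refl e x : agree e x x.
Proof. exact/agreeP. Qed.

Lemma agree_sym e x y : agree e x y = agree e y x.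
Proof. by apply/agreeP/agreeP=> H k /H. Qed.

Lemma agree_trans e x y z : agree e x y -> agree e y z -> agree e x z.
Proof. by move=> /agreeP H /agreeP K; apply/agreeP=> k ke; rewrite H ?K. Qed.

Lemma agree_le e f x y : e <= f -> agree f x y -> agree e x y.
Proof. by move=> ef /agreeP H; apply/agreeP=> k ke; apply: H; apply: leq_trans ef. Qed.

Lemma agree_trans_eq e x y z : agree e x y -> agree e x z = agree e y z.
Proof.
move=> xy; apply/idP/idP=> H; last exact: agree_trans xy H.
by apply: agree_trans H; rewrite agree_sym.
Qed.

Lemma agree_all x y : agree n x y -> x = y.
Proof. by move=> /agreeP H; apply/ffunP=> k; apply: H. Qed.

Definition flip i x : Q := [ffun k => if k == i then ~~ x k else x k].

Lemma flipK i : involutive (flip i).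
Proof. by move=> x; apply/ffunP=> k; rewrite !ffunE; case: eqP; rewrite ?negbK. Qed.

Lemma agree_flip e i x : agree e x (flip i x) = (e <= i).
Proof.
apply/agreeP/idP=> [H|ei k ke].
  by rewrite leqNgt; apply/negP=> /H; rewrite ffunE eqxx; case: (x i).
by rewrite ffunE; case: eqP => // ek; move: ke; rewrite ek ltnNge ei.
Qed.

Lemma agree_flip2 e i x y : agree e x y -> agree e (flip i x) (flip i y).
Proof. by move=> /agreeP H; apply/agreeP=> k /H; rewrite !ffunE => ->. Qed.

Lemma card_agree e x : e <= n -> #|[set y | agree e x y]| = 2 ^ (n - e).
Proof.
elim: e => [|e IH] en.
  rewrite subn0 -[n in RHS]card_ord -card_bool -card_ffun -cardsT; apply: eq_card => y.
  by rewrite !inE; apply/agreeP.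
pose i := Ordinal en.
have ie : agree e x (flip i x) by rewrite agree_flip.
have split_e : [set y | agree e x y] =
    [set y | agree e.+1 x y] :|: flip i @: [set y | agree e.+1 x y].
  apply/setP=> y; rewrite !inE; apply/idP/idP=> [|/orP[|/imsetP[z + ->]]].
  - move=> xy; case: (eqVneq (x i) (y i)) => xyi; apply/orP; [left|right].
      apply/agreeP=> k; rewrite ltnS leq_eqVlt => /orP[/eqP ek|]; last by apply/agreeP.
      by have -> : k = i by apply: val_inj.
    apply/imsetP; exists (flip i y); rewrite ?flipK // inE.
    apply/agreeP=> k; rewrite ffunE; case: eqP => [-> _|ki].
      by move: xyi; case: (x i); case: (y i).
    rewrite ltnS leq_eqVlt => /orP[/eqP ek|]; last by apply/agreeP.
    by case: ki; apply: val_inj.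
  - exact: agree_le (leqnSn e).
  - rewrite inE => /(agree_le (leqnSn e)) xz; apply: agree_trans xz _.
    by rewrite agree_flip.
have := IH (ltnW en); rewrite split_e cardsU card_imset; last exact: can_inj (flipK i).
rewrite (_ : _ :&: _ = set0) ?cards0 ?subn0; last first.
  apply/setP=> y; rewrite !inE; apply/negP=> /andP[/agreeP/(_ i (ltnSn e)) xy /imsetP[z + yz]].
  rewrite inE => /agreeP/(_ i (ltnSn e)) xz.
  by move: xy; rewrite xz yz ffunE eqxx; case: (z i).
by rewrite (_ : n - e = (n - e.+1).+1) ?expnS; lia.
Qed.

Lemma adjacent_flip x y : cube_adj n x y -> exists i, y = flip i x.
Proof.
case/cards1P=> i xy; exists i; apply/ffunP=> k; rewrite ffunE.
have := in_set1 k i; rewrite -xy inE => <-.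
by case: (x k); case: (y k).
Qed.

End Cube.

(** * The tree of clique-free pieces *)

Section Pieces.

Variables (V : finType) (blue : rel V).
Hypothesis blue_sym : symmetric blue.
Hypothesis blue_irr : irreflexive blue.

Definition clique_free u (A : {set V}) :=
  [forall C : {set V}, (C \subset A) && (#|C| == u) ==>
     ~~ [forall a in C, forall b in C, (a != b) ==> blue a b]].

(* A nonempty set is never clique-free for u = 1; singletons play that role. *)
Definition admissible u (A : {set V}) := (#|A| <= 1) || clique_free u A.

(** A blue K_u among blue neighbours of v would extend by v to a blue K_(u+1) in A. *)
Lemma clique_free_nbhd u (A T : {set V}) v :
  clique_free u.+1 A -> v \in A -> T \subset A ->
  {in T, forall w, blue v w} -> clique_free u T.
Proof.
move=> /forallP kA vA TA bT; apply/forallP=> C; apply/implyP=> /andP[CT /eqP cC].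
apply/negP=> /forall_inP bC.
have vC : v \notin C.
  by apply/negP=> vC; have := bT v (subsetP CT _ vC); rewrite blue_irr.
have /implyP := kA (v |: C); rewrite cardsU1 vC cC add1n eqxx andbT.
rewrite subUset sub1set vA (subset_trans CT TA) => /(_ isT)/negP; apply.
apply/forall_inP=> a; rewrite !inE => aC; apply/forall_inP=> b; rewrite !inE => bC'.
apply/implyP=> ab; case/orP: aC => [/eqP ea|aC]; case/orP: bC' => [/eqP eb|bC'].
- by rewrite ea eb eqxx in ab.
- by rewrite ea; apply: bT; apply: (subsetP CT).
- by rewrite eb blue_sym; apply: bT; apply: (subsetP CT).
- by have /forall_inP/(_ b bC')/implyP := bC a aC; apply.
Qed.

(** * Greedy cutting into pieces *)

Definition disjoint_family u (R : {set V}) d (F : {set {set V}}) :=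
  trivIset F && [forall T in F, [&& T \subset R, #|T| == d & admissible u T]].

Definition max_family u R d :=
  [arg max_(F > set0 | disjoint_family u R d F) #|F|]%N.

Lemma disjoint_family0 u R d : disjoint_family u R d set0.
Proof.
apply/andP; split; first by apply/trivIsetP=> A B; rewrite inE.
by apply/forall_inP=> T; rewrite inE.
Qed.

Lemma max_familyP u R d : disjoint_family u R d (max_family u R d).
Proof. by rewrite /max_family; case: arg_maxnP => //; apply: disjoint_family0. Qed.

(** Such a set could be added to the family; d > 0 ensures that it is not already a member. *)
Lemma max_family_max u (R T : {set V}) d : 0 < d ->
  T \subset R :\: cover (max_family u R d) -> #|T| = d -> ~~ admissible u T.
Proof.
rewrite /max_family; case: arg_maxnP => [|F FF Fmax d0]; first exact: disjoint_family0.
move=> TR cT; apply/negP=> aT; case/andP: FF => tF /forall_inP FF.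
have dT (S : {set V}) : S \in F -> [disjoint T & S].
  move=> SF; rewrite disjoint_sym disjoints_subset; apply/subsetP=> x xS; rewrite inE.
  apply/negP=> /(subsetP TR); rewrite inE => /andP[/negP nx _]; apply: nx.
  by apply/bigcupP; exists S.
have nT : T \notin F.
  apply/negP=> /dT; rewrite -setI_eq0 setIid => /eqP T0.
  by move: cT d0; rewrite T0 cards0 => <-.
have := Fmax (T |: F); rewrite /= cardsU1 nT add1n ltnn => H.
suff /H : disjoint_family u R d (T |: F) by [].
apply/andP; split.
  apply/trivIsetP=> A B; rewrite !inE => /orP[/eqP->|AF] /orP[/eqP->|BF] AB.
  - by rewrite eqxx in AB.
  - exact: dT.
  - by rewrite disjoint_sym; apply: dT.
  - by move/trivIsetP: tF; apply.
apply/forall_inP=> S; rewrite !inE => /orP[/eqP->|/FF//].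
by rewrite cT eqxx aT (subset_trans TR (subsetDl _ _)).
Qed.

Definition blue_degree v (R : {set V}) := #|[set w in R | blue v w]|.

(** Greedy choice: pick v and delete it with its blue neighbours, at most d vertices in all, k
    times. *)
Lemma clique_of_low_degree d (R : {set V}) k : 0 < d ->
  {in R, forall v, blue_degree v R < d} -> k * d <= #|R| ->
  exists2 C : {set V}, C \subset R & #|C| = k /\
     {in C &, forall a b, ~~ blue a b}.
Proof.
move=> d0; elim: k R => [|k IH] R dR.
  by exists set0; rewrite ?sub0set // cards0; split=> // a b; rewrite inE.
case: (set_0Vmem R) => [->|[v vR] kR].
  by rewrite cards0 mulSn leqn0 addn_eq0 => /andP[/eqP d00]; rewrite d00 in d0.
pose N := v |: [set w in R | blue v w].
have cN : #|N| <= d.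
  by rewrite cardsU1; apply: leq_trans (dR v vR); rewrite -add1n leq_add2r leq_b1.
have [|/= |C CR [cC bC]] := IH (R :\: N).
- move=> w /setDP[wR _]; apply: leq_ltn_trans (dR w wR); apply: subset_leq_card.
  by apply/subsetP=> x; rewrite !inE => /andP[/andP[_ ->] ->].
- have := cardsID N R; have : #|R :&: N| <= #|N| by rewrite subset_leq_card ?subsetIr.
  by move: kR cN; rewrite mulSn; lia.
have nC w : w \in C -> (w != v) && ~~ blue v w.
  by move/(subsetP CR); rewrite !inE negb_or => /andP[/andP[-> H]] wR; rewrite wR in H.
have vC : v \notin C by apply/negP=> /nC; rewrite eqxx.
exists (v |: C).
  by rewrite subUset sub1set vR (subset_trans CR (subsetDl _ _)).
rewrite cardsU1 vC cC add1n; split=> // a b; rewrite !inE.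
case/orP=> [/eqP->|aC] /orP[/eqP->|bC'].
- by rewrite blue_irr.
- by case/andP: (nC _ bC').
- by rewrite blue_sym; case/andP: (nC _ aC).
- exact: bC.
Qed.

Variable kap : nat -> nat.
Hypothesis kap_gt0 : forall u, 0 < kap u.
Hypothesis kap1 : kap 1 = 1.

(** Rounds run from large pieces to small, the size halving each time, so that later pieces lie in a
    set of small blue degree. *)
Fixpoint remainder u m (A : {set V}) f : {set V} :=
  if f is f'.+1 then
    remainder u m A f' :\: cover (max_family u (remainder u m A f') (kap u * 2 ^ (m - f')))
  else A.

Definition pieces u m A f := max_family u (remainder u m A f) (kap u * 2 ^ (m - f)).

Lemma pieces_props u m A f T : T \in pieces u m A f ->
  [/\ T \subset remainder u m A f, #|T| = kap u * 2 ^ (m - f) & admissible u T].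
Proof.
case/andP: (max_familyP u (remainder u m A f) (kap u * 2 ^ (m - f))) => _.
by move=> /forall_inP H /H /and3P[? /eqP].
Qed.

Lemma remainder_mono u m A f g : f <= g -> remainder u m A g \subset remainder u m A f.
Proof.
elim: g => [|g IH]; first by rewrite leqn0 => /eqP->.
rewrite leq_eqVlt => /orP[/eqP-> //|]; rewrite ltnS => /IH; apply: subset_trans.
exact: subsetDl.
Qed.

Lemma pieces_sub u m A f T : T \in pieces u m A f -> T \subset A.
Proof.
by case/pieces_props=> H _ _; apply: subset_trans H (remainder_mono u m A (leq0n f)).
Qed.

Lemma pieces_lt_disjoint u m A f g T S : f < g ->
  T \in pieces u m A f -> S \in pieces u m A g -> [disjoint T & S].
Proof.
move=> fg Tf /pieces_props[SR _ _]; rewrite disjoint_sym disjoints_subset.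
apply/subsetP=> x /(subsetP SR) /(subsetP (remainder_mono u m A fg)) /=.
by rewrite !inE => /andP[H _]; apply: contra H => xT; apply/bigcupP; exists T.
Qed.

Lemma pieces_disjoint u m A f g T S : (f, T) != (g, S) ->
  T \in pieces u m A f -> S \in pieces u m A g -> [disjoint T & S].
Proof.
case: (ltngtP f g) => [fg|gf|->] ne Tf Sg.
- exact: pieces_lt_disjoint fg Tf Sg.
- by rewrite disjoint_sym; apply: pieces_lt_disjoint gf Sg Tf.
case/andP: (max_familyP u (remainder u m A g) (kap u * 2 ^ (m - g))) => /trivIsetP tF _.
by apply: tF => //; apply: contra ne => /eqP->.
Qed.

(** Otherwise [kap u * 2 ^ (m - f)] blue neighbours of v would form a K_u-free set that round f
    could still have cut. *)
Lemma remainder_degree u m A f v : clique_free u.+1 A ->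
  v \in remainder u m A f.+1 ->
  blue_degree v (remainder u m A f.+1) < kap u * 2 ^ (m - f).
Proof.
move=> kA vR; rewrite ltnNge; apply/negP=> /card_geqP.
case=> s [us cs sR].
pose T := [set x in s].
have cT : #|T| = kap u * 2 ^ (m - f) by rewrite cardsE (card_uniqP us).
have TR : T \subset remainder u m A f.+1.
  by apply/subsetP=> x; rewrite inE => /sR; rewrite inE => /andP[].
have RA := remainder_mono u m A (leq0n f.+1).
have := max_family_max _ TR cT; rewrite muln_gt0 kap_gt0 expn_gt0 => /(_ isT)/negP; apply.
apply/orP; right; apply: (clique_free_nbhd kA (subsetP RA _ vR)).
  exact: subset_trans TR RA.
by move=> w; rewrite inE => /sR; rewrite inE => /andP[].
Qed.

Lemma admissible_red u (T : {set V}) : 0 < u -> #|T| = kap u ->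
  {in T &, forall a b, ~~ blue a b} -> admissible u T.
Proof.
(* For u = 1 no nonempty set is K_1-free; there [kap1] makes T a singleton. *)
case: u => // -[|u] _ cT rT; first by rewrite /admissible cT kap1.
apply/orP; right; apply/forallP=> C; apply/implyP=> /andP[CT /eqP cC].
have /card_geqP[s [us ss sC]] : 2 <= #|C| by rewrite cC.
case: s us ss sC => [|a [|b [|]]] //= /andP[]; rewrite inE => ab _ _ sC.
have aC : a \in C by rewrite sC ?inE ?eqxx.
have bC : b \in C by rewrite sC ?inE ?eqxx ?orbT.
apply/negP=> /forall_inP/(_ a aC)/forall_inP/(_ b bC)/implyP/(_ ab).
by apply/negP; apply: rT; apply: (subsetP CT).
Qed.

(** In a larger leftover the low blue degrees would give a red set of [kap u] vertices, which round
    m could still have cut. *)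
Lemma pieces_leftover u m A : 0 < u -> clique_free u.+1 A ->
  #|remainder u m A m.+1| < kap u * kap u.
Proof.
move=> u0 kA; rewrite ltnNge; apply/negP=> big.
have dR : {in remainder u m A m.+1, forall v, blue_degree v (remainder u m A m.+1) < kap u}.
  by move=> v /(remainder_degree kA); rewrite subnn muln1.
have [C CR [cC rC]] := clique_of_low_degree (kap_gt0 u) dR big.
have := max_family_max _ CR; rewrite subnn muln1 => /(_ (kap_gt0 u) cC)/negP; apply.
exact: admissible_red.
Qed.

Lemma remainder_card u m (A : {set V}) f :
  #|A| = #|remainder u m A f| + \sum_(g < f) \sum_(T in pieces u m A g) #|T|.
Proof.
elim: f => [|f IH]; first by rewrite big_ord0 addn0.
rewrite big_ord_recr /= addnA IH; set F := max_family _ _ _.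
have tF : trivIset F by case/andP: (max_familyP u (remainder u m A f) (kap u * 2 ^ (m - f))).
rewrite -[\sum_(T in pieces _ _ _ _) _]/(\sum_(T in F) #|T|).
rewrite (eqP tF : \sum_(T in F) #|T| = #|cover F|).
have sF : cover F \subset remainder u m A f.
  by apply/bigcupsP=> T /pieces_props[].
by rewrite -(cardsID (cover F) (remainder u m A f)) (setIidPr sF) [X in X + _ = _]addnC addnAC.
Qed.

Lemma pieces_mass u m (A : {set V}) : 0 < u -> clique_free u.+1 A ->
  #|A| < \sum_(g < m.+1) \sum_(T in pieces u m A g) #|T| + kap u * kap u.
Proof.
by move=> u0 kA; rewrite {1}(remainder_card u m A m.+1) addnC ltn_add2l pieces_leftover.
Qed.

Definition blue_edges (A B : {set V}) : nat := \sum_(a in A) \sum_(b in B) blue a b.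

Lemma blue_edgesC A B : blue_edges A B = blue_edges B A.
Proof.
rewrite /blue_edges exchange_big; apply: eq_bigr => b _; apply: eq_bigr => a _.
by rewrite blue_sym.
Qed.

Lemma sum_blue v (R : {set V}) : \sum_(b in R) blue v b = blue_degree v R.
Proof.
rewrite /blue_degree -sum1_card [RHS](eq_bigl (fun b => (b \in R) && blue v b)).
  by rewrite -big_mkcondr; apply: eq_bigr => b; case: (blue v b).
by move=> b; rewrite inE.
Qed.

(** * Nodes of the tree *)

Variables (s n : nat).
Hypothesis s_gt0 : 0 < s.
Hypothesis cardV : #|V| = kap s * 2 ^ n.

(* A node of the tree of sets is listed with its ancestors, deepest first, each with
   its scale e, the codimension of the subcube it can host; the root is [::].
   A node of length l is clique-free for s - l. *)
Definition node := seq (nat * {set V}).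
Implicit Types (p q : node).

Definition scale p := (head (0, setT) p).1.
Definition piece p := (head (0, setT) p).2.

(** The scale [c.1] is absolute, so the round of the cut is its excess over [scale p]. The bound on
    the length keeps the clique parameter of the child positive. *)
Definition child p (c : nat * {set V}) :=
  [&& scale p <= c.1, c.1 <= n, (size p).+1 < s &
      c.2 \in pieces (s - (size p).+1) (n - scale p) (piece p) (c.1 - scale p)].

Fixpoint valid p := if p is c :: p' then child p' c && valid p' else true.

Lemma valid_suffix p q : suffix q p -> valid p -> valid q.
Proof. by case/suffixP=> r ->; elim: r => //= c r IH /andP[_ /IH]. Qed.

Lemma scale_suffix p q : valid p -> suffix q p -> scale q <= scale p.
Proof.
move=> + /suffixP[r ep]; elim: r p ep => [|c r IH] p -> //= /andP[/and4P[sc _ _ _]].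
by move=> /IH H; apply: leq_trans (H erefl) sc.
Qed.

Lemma valid_scale p : valid p -> scale p <= n.
Proof. by case: p => //= c p /andP[/and4P[]]. Qed.

Lemma valid_size p : valid p -> size p < s.
Proof. by case: p => //= c p /andP[/and4P[]]. Qed.

Lemma valid_piece p : valid p -> admissible s setT ->
  #|piece p| = kap (s - size p) * 2 ^ (n - scale p) /\ admissible (s - size p) (piece p).
Proof.
case: p => [|c p] /=; first by rewrite !subn0 cardsT.
case/andP=> /and4P[sc cn _ /pieces_props[_ cT aT]] _ _; split=> //.
by rewrite cT /scale /=; congr (_ * 2 ^ _); move: sc cn; rewrite /scale; lia.
Qed.

Lemma child_sub p c : child p c -> c.2 \subset piece p.
Proof. by case/and4P=> _ _ _; apply: pieces_sub. Qed.

Lemma piece_suffix p q : valid p -> suffix q p -> piece p \subset piece q.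
Proof.
move=> + /suffixP[r ep]; elim: r p ep => [|c r IH] p -> //= /andP[/child_sub cs].
by move=> /IH H; apply: subset_trans cs (H erefl).
Qed.

Lemma child_disjoint p c d : child p c -> child p d -> c != d -> [disjoint c.2 & d.2].
Proof.
case: c d => [e T] [f S] /and4P[/= pe _ _ eT] /and4P[/= pf _ _ fS] cd.
apply: pieces_disjoint eT fS; apply: contra cd => /eqP[ef ->]; apply/eqP; congr pair.
by move: pe pf ef; lia.
Qed.

Lemma valid_disjoint p q : valid p -> valid q -> size p = size q -> p != q ->
  [disjoint piece p & piece q].
Proof.
elim: p q => [|c p IH] [|d q] //= /andP[cp vp] /andP[dq vq] [sz] ne.
case: (eqVneq p q) => [epq|pq].
  by subst q; apply: (child_disjoint cp dq); apply: contra ne => /eqP->.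
have := IH _ vp vq sz pq; rewrite !disjoints_subset => H.
apply: subset_trans (child_sub cp) (subset_trans H _).
by rewrite setCS; apply: child_sub.
Qed.

(* As subcubes are assigned by increasing codimension, [trunc e (st x)] recovers the
   node that held x at stage e. *)
Fixpoint trunc e p := if p is c :: p' then (if c.1 <= e then p else trunc e p') else p.

Lemma trunc_suffix e p : suffix (trunc e p) p.
Proof.
elim: p => [|c p IH] /=; first exact: suffix_refl.
by case: ifP => _; rewrite ?suffix_refl // suffix_consE IH orbT.
Qed.

Lemma scale_trunc e p : scale (trunc e p) <= e.
Proof. by elim: p => //= c p IH; case: ifP. Qed.

Lemma trunc_id e p : scale p <= e -> trunc e p = p.
Proof. by case: p => //= c p; rewrite /scale /= => ->. Qed.

Lemma suffix_trunc e p q : suffix q p -> valid p -> scale q <= e -> suffix q (trunc e p).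
Proof.
elim: p => //= c p IH qp /andP[cp vp] qe; case: ifP => // ce; apply: IH => //.
by move: qp; rewrite suffix_consE => /orP[/eqP eq|//]; move: qe; rewrite eq /scale /= ce.
Qed.

Local Notation Q := (cube_vert n).
Implicit Types (x y z : Q) (i : 'I_n).

(** * Assigning subcubes to nodes *)

Variable th : nat -> nat -> rat.

(** Blue density above [th k r], without division. Here k is the sum of two depths, and r the
    distance from the scale of the smallest common node to the flipped coordinate. *)
Definition heavy k r (A B : {set V}) : bool :=
  (th k r * #|A|%:R * #|B|%:R < (blue_edges A B)%:R)%R.

Lemma heavyC k r A B : heavy k r A B = heavy k r B A.
Proof. by rewrite /heavy blue_edgesC -!mulrA [(#|A|%:R * _)%R]mulrC. Qed.

Implicit Types st : Q -> node.

(* A node is assigned to exactly one subcube of codimension its scale. *)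
Definition coherent st :=
  (forall x, valid (st x)) /\
  (forall x p, suffix p (st x) -> forall y, suffix p (st y) = agree (scale p) x y).

(* [trunc i p] is the smallest node whose subcube contains both x and [flip i x];
   the two inequalities on [i] say that p and q are not nested. *)
Definition sparse_at st e :=
  forall x i, let p := trunc e (st x) in let q := trunc e (st (flip i x)) in
  i < scale p -> i < scale q ->
  ~~ heavy (size p + size q) (i - scale (trunc i p)) (piece p) (piece q).

Definition used st p := [exists y, suffix p (st y)].

(** Sparsity would fail if T became the node of x at stage e; i < e says that [flip i x] lies
    outside the codimension e subcube of x. *)
Definition blocked st e x T :=
  let p := trunc e (st x) in
  [exists i : 'I_n, let q := trunc e (st (flip i x)) in
     [&& i < e, i < scale q &
         heavy ((size p).+1 + size q) (i - scale (trunc i p)) T (piece q)]].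

Definition saturated_at st e :=
  forall x T, child (trunc e (st x)) (e, T) ->
  used st ((e, T) :: trunc e (st x)) || blocked st e x T.

(** The state while scale e is processed: coarser scales are finished, finer ones untouched. *)
Definition partial_stage st e :=
  [/\ coherent st, forall x, scale (st x) <= e,
      forall f, f <= e -> sparse_at st f & forall f, f < e -> saturated_at st f].

(** A node of scale at most e is held by whole subcubes of codimension e, so each truncation is a
    suffix of the other. *)
Lemma coherent_trunc st e x y : coherent st -> agree e x y ->
  trunc e (st x) = trunc e (st y).
Proof.
case=> vst cst xy.
have half z w : agree e z w -> suffix (trunc e (st z)) (trunc e (st w)).
  move=> zw; apply: suffix_trunc => //; last exact: scale_trunc.
  rewrite (cst z) ?trunc_suffix //; apply: agree_le zw; exact: scale_trunc.
by apply: suffix_antisym; apply: half; rewrite // agree_sym.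
Qed.

(** * Assigning one more piece *)

Section Push.

Variables (st : Q -> node) (e : nat) (x0 : Q) (T : {set V}).
Hypotheses (pst : partial_stage st e) (chT : child (st x0) (e, T)).
Hypotheses (newT : ~~ used st ((e, T) :: st x0)) (freeT : ~~ blocked st e x0 T).

Let c := (e, T).
Definition push x := if agree e x0 x then c :: st x0 else st x.

Let cst : coherent st. Proof. by case: pst. Qed.
Let st_e x : trunc e (st x) = st x.
Proof. by case: pst => _ H _ _; apply: trunc_id. Qed.
Let st_agree x y : agree e x y -> st x = st y.
Proof. by move=> xy; rewrite -(st_e x) (coherent_trunc cst xy) st_e. Qed.

Lemma trunc_push f x : f < e -> trunc f (push x) = trunc f (st x).
Proof.
rewrite /push; case: ifP => // xx fe; rewrite -(st_agree xx) /= leqNgt.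
by rewrite fe.
Qed.

Lemma push_e x : trunc e (push x) = push x.
Proof. by rewrite /push; case: ifP => //= _; rewrite leqnn. Qed.

Lemma suffix_push p x : suffix p (st x) -> suffix p (push x).
Proof.
rewrite /push; case: ifP => // /st_agree <-; rewrite suffix_consE => ->.
by rewrite orbT.
Qed.

Lemma suffix_pushE p x : p != c :: st x0 -> suffix p (push x) = suffix p (st x).
Proof.
rewrite /push; case: ifP => // /st_agree <- /negPf.
by rewrite suffix_consE => ->.
Qed.

Lemma coherent_push : coherent push.
Proof.
case: cst => vst agst; split=> [x|x p].
  by rewrite /push; case: ifP => //= _; rewrite chT vst.
case: (eqVneq p (c :: st x0)) => [-> + y|ne]; last first.
  by rewrite suffix_pushE // => px y; rewrite suffix_pushE //; apply: agst.
have nu z : ~~ agree e x0 z -> suffix (c :: st x0) (push z) = false.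
  move=> /negPf xz; rewrite /push xz; apply/negbTE.
  by apply: contra newT => H; apply/existsP; exists z.
case xx: (agree e x0 x); last by rewrite nu ?xx.
rewrite [scale _]/= -(agree_trans_eq y xx) => _.
case xy: (agree e x0 y); last by rewrite nu ?xy.
by rewrite /push xy suffix_refl.
Qed.

Lemma sparse_push : sparse_at push e.
Proof.
case: (pst) => _ sc_e sp _.
(* Edges leaving the new subcube: that T is not blocked at x0 transfers by coherence to every z of
   the subcube. *)
have key z i : agree e x0 z -> ~~ agree e x0 (flip i z) ->
    i < scale (st (flip i z)) ->
    ~~ heavy ((size (st x0)).+1 + size (st (flip i z)))
         (i - scale (trunc i (st x0))) T (piece (st (flip i z))).
  move=> xz nxf isc.
  have ie : i < e.
    by rewrite ltnNge; apply: contra nxf => ei; apply: agree_trans xz _; rewrite agree_flip.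
  have ef : st (flip i z) = st (flip i x0).
    by apply: st_agree; apply: agree_flip2; rewrite agree_sym.
  apply: contra freeT => H; apply/existsP; exists i.
  by rewrite /= !st_e ie -ef isc H.
move=> x i /=; rewrite !push_e {1 3 5 6}/push.
case xx: (agree e x0 x).
  case xf: (agree e x0 (flip i x)).
    rewrite /push xf /scale /= => ie.
    have : agree e x (flip i x) by rewrite -(agree_trans_eq _ xx).
    by rewrite agree_flip leqNgt ie.
  rewrite /push xf => ie isc; rewrite [size (_ :: _)]/= [piece (_ :: _)]/=.
  have -> : trunc i (c :: st x0) = trunc i (st x0) by rewrite /= leqNgt ie.
  by apply: key; rewrite ?xf.
rewrite /push; case xf: (agree e x0 (flip i x)); last first.
  by move=> *; have := sp e (leqnn e) x i; rewrite /= !st_e; apply.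
(* Only [flip i x] lies in the new subcube; the symmetry of [heavy] swaps the roles. *)
move=> isc ie.
have ii : trunc i (st x) = trunc i (st x0).
  rewrite (coherent_trunc (y := flip i x) cst) ?agree_flip //.
  by rewrite (st_agree xf).
rewrite ii heavyC addnC; have := @key (flip i x) i xf; rewrite flipK xx.
by apply.
Qed.

Lemma partial_stage_push : partial_stage push e.
Proof.
case: (pst) => _ sc_e sp sa; split.
- exact: coherent_push.
- by move=> x; rewrite /push; case: ifP.
- move=> f; rewrite leq_eqVlt => /orP[/eqP->|fe]; first exact: sparse_push.
  by move=> x i /=; rewrite !trunc_push //; apply: sp; apply: ltnW.
move=> f fe x S; rewrite !trunc_push // => /(sa f fe) /orP[/existsP[y uy]|/existsP[i bl]].
  by apply/orP; left; apply/existsP; exists y; apply: suffix_push.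
by apply/orP; right; apply/existsP; exists i; rewrite /= !trunc_push.
Qed.

Lemma size_push : \sum_x size (st x) < \sum_x size (push x).
Proof.
rewrite (bigD1 x0) //= [ltnRHS](bigD1 x0) //= -addSn; apply: leq_add.
  by rewrite /push agree_refl.
by apply: leq_sum => x _; apply: size_suffix; apply/suffix_push/suffix_refl.
Qed.

End Push.

(** Each push increases the total length of the nodes, while every length stays below s, so pushing
    stops. *)
Lemma saturate st e : partial_stage st e ->
  exists2 st', partial_stage st' e & saturated_at st' e.
Proof.
have [k] := ubnP (\sum_(x : Q) s - \sum_x size (st x)).
elim: k st => // k IH st bound pst.
have st_e x : trunc e (st x) = st x by case: pst => _ H _ _; apply: trunc_id.
case: (boolP [forall x, forall T, child (st x) (e, T) ==>
   (used st ((e, T) :: st x) || blocked st e x T)]) => [/forallP H|].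
  exists st => // x T; rewrite st_e => ch.
  by have /forallP/(_ T)/implyP/(_ ch) := H x.
case/forallPn=> x /forallPn[T]; rewrite negb_imply negb_or => /and3P[ch nu nb].
have pp := partial_stage_push pst ch nu nb.
apply: (IH _ _ pp); move: bound; have := size_push x T pst.
have : \sum_y size (push st e x T y) <= \sum_(y : Q) s.
  by apply: leq_sum => y _; apply: ltnW; apply: valid_size; case: pp => -[].
by lia.
Qed.

Lemma saturated_exists :
  exists st, [/\ coherent st, forall e, e <= n -> sparse_at st e &
                 forall e, e <= n -> saturated_at st e].
Proof.
suff [st [cst _ sp sa]] : exists st, partial_stage st n.+1.
  by exists st; split=> // e en; apply: sp; apply: ltnW.
elim: n.+1 => [|e [st /saturate[st' [cst sc sp sa] sae]]].
  exists (fun=> [::]); split=> //; split=> // x p; rewrite suffixs0 => /eqP-> y.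
  by rewrite eqxx; apply/esym/agreeP.
exists st'; split=> //; first by move=> x; apply: leqW.
  (* All scales are at most e, so truncating at e or at e + 1 changes nothing and sparsity carries
     over. *)
  move=> f; rewrite leq_eqVlt => /orP[/eqP->|]; last exact: sp.
  move=> x i /=; have := sp e (leqnn e) x i.
  by rewrite /= !(trunc_id (sc _)) !(trunc_id (leqW (sc _))).
by move=> f; rewrite ltnS leq_eqVlt => /orP[/eqP->|]; [exact: sae|exact: sa].
Qed.

(** * Counting the pieces below a stuck vertex *)

Variables (K del lam : rat).
Hypotheses (lam_ge0 : (0 <= lam)%R) (lam_lt1 : (lam < 1)%R).
Hypothesis th_gt0 : forall k r, (0 < th k r)%R.
(** The growth (4/3)^r is affordable: blue degrees at distance r shrink by 2^r, which leaves
    (2/3)^r. *)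
Hypothesis th_inv : forall k r, ((th k r)^-1 <= K * (4 / 3) ^+ r)%R.
(** Refining one of two nodes divides the admissible density by [del * lam ^+ r]; by averaging, this
    bounds the fraction of a set lost to a node already sparse to it. *)
Hypothesis th_step : forall k r, k.+1 < s.*2 -> (th k r = del * lam ^+ r * th k.+1 r)%R.
Hypothesis del_ge0 : (0 <= del)%R.
Hypothesis del_small : (s%:R * s%:R * del * (1 - lam)^-1 <= 8^-1)%R.
Hypothesis kap_growth : forall u, 0 < u ->
  ((kap u)%:R * (kap u)%:R + (kap u)%:R * (1 + 3 * s%:R * K) <= 7 / 8 * (kap u.+1)%:R)%R.
Hypothesis V_admissible : admissible s setT.

Section Stuck.

Variables (st : Q -> node) (x : Q).
Hypothesis cst : coherent st.
Hypothesis sp : forall e, e <= n -> sparse_at st e.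
Hypothesis sat : forall e, e <= n -> saturated_at st e.
Hypothesis stuck : (size (st x)).+1 < s.

Let p := st x.
Let A := piece p.
Let u := s - (size p).+1.
Let m := n - scale p.
Let Index : finType := ('I_m.+1 * {set V})%type.
Implicit Types c d : Index.
Let isp c := c.2 \in pieces u m A c.1.
Let at_scale (c : Index) := scale p + c.1.
Let kid (c : Index) := (at_scale c, c.2).

Let vp : valid p. Proof. by case: cst => + _; apply. Qed.
Let su : s - size p = u.+1. Proof. rewrite /u subnSK //; exact: ltnW. Qed.
Let u_gt0 : 0 < u. Proof. by rewrite /u subn_gt0; exact: stuck. Qed.
Let cA : #|A| = kap u.+1 * 2 ^ m.
Proof. by have [] := valid_piece vp V_admissible; rewrite su. Qed.
Let kA : clique_free u.+1 A.
Proof.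
have [_] := valid_piece vp V_admissible; rewrite su => /orP[] //; rewrite -/A => A1.
apply/forallP=> C; apply/implyP=> /andP[CA /eqP cC].
by have := leq_trans (subset_leq_card CA) A1; rewrite cC; move: u_gt0; lia.
Qed.

Let at_scale_le c : at_scale c <= n.
Proof. by have := valid_scale vp; have := ltn_ord c.1; rewrite /at_scale /m; lia. Qed.

Let kid_child c : isp c -> child p (kid c).
Proof. by move=> Pc; rewrite /child leq_addr at_scale_le stuck /= addKn. Qed.

Let kid_disjoint c d : isp c -> isp d -> c != d -> [disjoint c.2 & d.2].
Proof.
move=> Pc Pd cd; apply: pieces_disjoint Pc Pd; apply: contra cd => /eqP[e1 e2].
by case: c d e1 e2 => [a b] [a' b'] /= /val_inj -> ->.
Qed.

Let card_kid c : isp c -> #|c.2| = kap u * 2 ^ (m - c.1).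
Proof. by case/pieces_props. Qed.

(** A used piece has [kap u] times as many vertices as its subcube, and these subcubes are disjoint
    inside the subcube of p, of size 2^m. *)
Lemma used_mass : \sum_(c | isp c && used st (kid c :: p)) #|c.2| <= kap u * 2 ^ m.
Proof.
pose D c := [set z | suffix (kid c :: p) (st z)].
have -> : 2 ^ m = #|[set z | suffix p (st z)]|.
  rewrite /m -(card_agree x (valid_scale vp)); apply: eq_card => z; rewrite !inE.
  by case: cst => _ /(_ x p (suffix_refl _)) ->.
have cD c : isp c -> used st (kid c :: p) -> #|c.2| = kap u * #|D c|.
  move=> Pc /existsP[y uy]; rewrite card_kid //; congr (_ * _).
  have -> : D c = [set z | agree (at_scale c) y z].
    by apply/setP=> z; rewrite !inE; case: cst => _ /(_ y _ uy) ->.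
  by rewrite card_agree ?at_scale_le // /at_scale subnDA.
under eq_bigr => c /andP[Pc uc] do rewrite cD // -sum1_card.
rewrite -big_distrr leq_mul2l -sum1_card; apply/orP; right.
apply: sum_disjoint => [c /andP[Pc _]|c d /andP[Pc _] /andP[Pd _] cd].
  apply/subsetP=> z; rewrite !inE; apply: suffix_trans.
  by rewrite suffix_consE suffix_refl orbT.
rewrite disjoints_subset; apply/subsetP=> z; rewrite !inE => zc; apply: contra cd => zd.
have /eqP := suffix_total zc zd (leqnn _).
rewrite suffixE subnn drop0 => /eqP/eqP[e1 e2].
case: c d Pc Pd zc zd e1 e2 => [a b] [a' b'] _ _ _ _ /= e1 <-.
by rewrite /at_scale /= in e1; rewrite xpair_eqE eqxx andbT -val_eqE /=; lia.
Qed.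

Let Y i := st (flip i x).
(* The nodes that held the neighbour [flip i x] at some stage, indexed by length. *)
Let cut i l := drop (size (Y i) - l) (Y i).
Let lvl i l := (size p).+1 + size (cut i l).
Let gap i := i - scale (trunc i p).

Let obstructs i l (c : Index) :=
  [&& i < at_scale c, trunc (at_scale c) (Y i) == cut i l, i < scale (cut i l) &
      heavy (lvl i l) (gap i) c.2 (piece (cut i l))].

Let mass i l := \sum_(c | isp c && obstructs i l c) #|c.2|.

Let trunc_p c : trunc (at_scale c) (st x) = p.
Proof. by rewrite trunc_id // leq_addr. Qed.

Lemma mass_split :
  \sum_(c | isp c) #|c.2| <= kap u * 2 ^ m + \sum_(i < n) \sum_(l < s) mass i l.
Proof.
apply: leq_trans (leq_add used_mass (leqnn _)).
rewrite /mass; under [X in _ + X]eq_bigr => i _ do under eq_bigr => l _ do rewrite big_mkcondr.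
under [X in _ + X]eq_bigr => i _ do rewrite exchange_big.
rewrite exchange_big big_mkcondr -big_split; apply: leq_sum => c Pc /=.
case: ifP => [_|nu]; first exact: leq_addr.
rewrite add0n; have := sat (at_scale_le c) (x := x) (T := c.2).
rewrite trunc_p => /(_ (kid_child Pc)); rewrite nu => /existsP[i].
rewrite trunc_p => /and3P[ie iq hq].
have size_q : size (trunc (at_scale c) (Y i)) < s.
  by apply: valid_size; apply: valid_suffix (trunc_suffix _ _) _; case: cst => + _; apply.
rewrite (bigD1 i) // (bigD1 (Ordinal size_q)) //= [X in X + _ + _](_ : _ = #|c.2|).
  by rewrite -addnA leq_addr.
suff -> : obstructs i (size (trunc (at_scale c) (Y i))) c by [].
have eq_cut : cut i (size (trunc (at_scale c) (Y i))) = trunc (at_scale c) (Y i).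
  by have := trunc_suffix (at_scale c) (Y i); rewrite suffixE => /eqP.
by rewrite /obstructs /lvl /gap eq_cut ie iq eqxx hq.
Qed.

Let valid_cut i l : valid (cut i l).
Proof. by apply: valid_suffix (suffix_drop _ _) _; case: cst => + _; apply. Qed.

Let piece_cut_gt0 i l : 0 < #|piece (cut i l)|.
Proof.
by have [-> _] := valid_piece (valid_cut i l) V_admissible; rewrite muln_gt0 kap_gt0 expn_gt0.
Qed.

(** Obstructing pieces are disjoint, so their blue edges to the cut node add up inside R. *)
Lemma mass_edges i l (R : {set V}) :
  (forall c, isp c -> obstructs i l c -> c.2 \subset R) ->
  (th (lvl i l) (gap i) * (mass i l)%:R * #|piece (cut i l)|%:R
     <= (blue_edges R (piece (cut i l)))%:R)%R.
Proof.
move=> subR; rewrite /mass natr_sum mulr_sumr mulr_suml.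
apply: le_trans (_ : (\sum_(c | isp c && obstructs i l c)
    (blue_edges c.2 (piece (cut i l)))%:R <= _)%R).
  by apply: ler_sum => c /andP[_ /and4P[_ _ _ /ltW]].
rewrite -natr_sum ler_nat; apply: sum_disjoint => [c /andP[]|c d /andP[Pc _] /andP[Pd _]].
  exact: subR.
exact: kid_disjoint.
Qed.

(** Here p and the cut node were already non-nested, so sparsity at total depth one less bounds the
    blue edges from all of A. *)
Lemma mass_outer i l : i < scale p ->
  ((mass i l)%:R <= del * lam ^+ gap i * #|A|%:R :> rat)%R.
Proof.
move=> ip; case: (pickP (fun c => isp c && obstructs i l c)) => [c|no]; last first.
  by rewrite /mass big_pred0 // !mulr_ge0 ?exprn_ge0.
case/andP=> Pc /and4P[ie /eqP eq_cut iq _].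
have := sp (at_scale_le c) (x := x) (i := i).
rewrite trunc_p [trunc _ (st _)]eq_cut => /(_ ip iq); rewrite /heavy -leNgt -/(gap i) => light.
have := @mass_edges i l A (fun c Pc _ => pieces_sub Pc).
move=> /le_trans/(_ light); rewrite -/A.
have q_gt0 : (0 < #|piece (cut i l)|%:R :> rat)%R by rewrite ltr0n.
rewrite ler_pM2r // (@th_step (size p + size (cut i l))); last first.
  rewrite -addnn -addSn -addnS; apply: leq_add; first exact: ltnW stuck.
  exact: valid_size (valid_cut i l).
rewrite -[(_ + _).+1]/(lvl i l) => le_mass; rewrite -(ler_pM2l (th_gt0 (lvl i l) (gap i))).
by apply: le_trans le_mass _; rewrite mulrA [(del * _ * _)%R]mulrC.
Qed.

(** Here the neighbour lies in the subcube of p. The obstructing node sits in a child of p of scale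
    above i, and the pieces it obstructs are cut no earlier than that child, where its vertices have
    small blue degree. *)
Lemma mass_inner i l : scale p <= i ->
  ((mass i l)%:R <= (kap u)%:R * 2 ^+ m * K * (2 / 3) ^+ (i - scale p)%N :> rat)%R.
Proof.
move=> pi; have gi : gap i = i - scale p by rewrite /gap trunc_id.
have K_ge0 : (0 <= K)%R.
  by have := th_inv 0 0; rewrite expr0 mulr1; apply: le_trans; rewrite invr_ge0 ltW.
case: (pickP (fun c => isp c && obstructs i l c)) => [c0|no]; last first.
  by rewrite /mass big_pred0 // mulr_ge0 ?exprn_ge0 ?divr_ge0 // !mulr_ge0 ?exprn_ge0.
case/andP=> Pc0 /and4P[_ _ iq _].
have pY : suffix p (Y i).
  by case: cst => _ /(_ x p (suffix_refl _)) ->; rewrite agree_flip.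
have qY : suffix (cut i l) (Y i) := suffix_drop _ _.
have pq : suffix p (cut i l).
  case: (leqP (size p) (size (cut i l))) => [|/ltnW] sz; first exact: suffix_total pY qY sz.
  have := scale_suffix vp (suffix_total qY pY sz).
  by rewrite leqNgt (leq_ltn_trans pi iq).
(* The first step from p towards the cut node is the last entry of the prefix r. *)
have [c1 c1q] : exists c1 : nat * {set V}, suffix (c1 :: p) (cut i l).
  case/suffixP: pq => r er; case: (lastP r) er => [|r' c1] er.
    by move: iq; rewrite er ltnNge pi.
  by exists c1; rewrite er cat_rcons suffix_suffix.
have c1Y : suffix (c1 :: p) (Y i) := suffix_trans c1q qY.
(* Otherwise coherence would give the child c1 to x too, making [st x] longer than p. *)
have ic1 : i < c1.1.
  rewrite ltnNge; apply/negP=> c1i.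
  have : suffix (c1 :: p) (st x).
    case: cst => _ /(_ _ _ c1Y x) ->; rewrite agree_sym agree_flip; exact: c1i.
  by move=> /size_suffix; rewrite /= ltnn.
have /= /andP[ch1 _] := valid_suffix c1q (valid_cut i l).
have := ch1; case/and4P=> pc1 _ _; rewrite -/u -/m -/A => /pieces_props[c1R _ _].
(* The child c1 is cut at round f + 1, from a remainder whose degrees are controlled by round f. *)
have [f ef] : exists f, c1.1 - scale p = f.+1.
  exists (c1.1 - scale p).-1.
  by rewrite prednK // subn_gt0 (leq_ltn_trans pi ic1).
rewrite ef in c1R.
have qR : piece (cut i l) \subset remainder u m A f.+1.
  exact: subset_trans (piece_suffix (valid_cut i l) c1q) c1R.
have sub c : isp c -> obstructs i l c -> c.2 \subset remainder u m A f.+1.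
  move=> Pc /and4P[_ /eqP eq_cut _ _]; case/pieces_props: (Pc) => cR _ _.
  apply: subset_trans cR (remainder_mono _ _ _ _).
  have := scale_trunc (at_scale c) (Y i); rewrite eq_cut.
  rewrite -ef leq_subLR; apply: leq_trans; exact: scale_suffix (valid_cut i l) c1q.
have := mass_edges sub; rewrite blue_edgesC.
have edges : blue_edges (piece (cut i l)) (remainder u m A f.+1)
    <= #|piece (cut i l)| * (kap u * 2 ^ (m - (i - scale p))).
  rewrite /blue_edges -sum_nat_const; apply: leq_sum => v vq; rewrite sum_blue.
  apply: leq_trans (ltnW (remainder_degree kA (subsetP qR _ vq))) _.
  rewrite leq_mul2l leq_exp2l // leq_sub2l ?orbT // -ltnS -ef.
  exact: ltn_sub2r (leq_ltn_trans pi ic1) ic1.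
have q_gt0 : (0 < #|piece (cut i l)|%:R :> rat)%R by rewrite ltr0n.
rewrite -(ler_nat rat) natrM in edges.
move=> /le_trans/(_ edges); rewrite mulrC ler_pM2l // gi.
rewrite -ler_pdivlMl // => /le_trans; apply.
have im : i - scale p <= m by rewrite leq_sub2r // ltnW.
have -> : ((kap u * 2 ^ (m - (i - scale p)))%:R = (kap u)%:R * 2 ^+ m * (2^-1) ^+ (i - scale p)%N :> rat)%R.
  by rewrite natrM natrX (exprB im) ?unitfE // exprVn mulrA.
have -> : ((kap u)%:R * 2 ^+ m * K * (2 / 3) ^+ (i - scale p)%N =
    (kap u)%:R * 2 ^+ m * 2^-1 ^+ (i - scale p)%N * (K * (4 / 3) ^+ (i - scale p)%N) :> rat)%R.
  by rewrite (_ : 2 / 3 = 4 / 3 * 2^-1 :> rat)%R ?exprMn; [ring|field].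
by rewrite mulrC ler_wpM2l // !mulr_ge0 ?exprn_ge0.
Qed.

(* Each [gap i] is measured from one of the at most s ancestors of p, and from a given
   ancestor every gap occurs once. *)
Lemma gap_sum : (\sum_(i < n | (i < scale p)%N) lam ^+ gap i <= s%:R * (1 - lam)^-1)%R.
Proof.
apply: le_trans (_ : (\sum_(i < n) \sum_(l < s)
    (if (scale (drop l p) <= i)%N then lam ^+ (i - scale (drop l p))%N else 0) <= _)%R).
  rewrite big_mkcond; apply: ler_sum => i _.
  have term_ge0 (l : 'I_s) : (0 <= if (scale (drop l p) <= i)%N
      then lam ^+ (i - scale (drop l p))%N else 0)%R by case: ifP; rewrite ?exprn_ge0.
  case: ifP => _; last exact: sumr_ge0.
  have ls : size p - size (trunc i p) < s := leq_ltn_trans (leq_subr _ _) (valid_size vp).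
  have := trunc_suffix i p; rewrite suffixE => /eqP eq_drop.
  rewrite (bigD1 (Ordinal ls)) //= eq_drop scale_trunc lerDl.
  exact: sumr_ge0.
rewrite exchange_big /=.
have -> : (s%:R * (1 - lam)^-1 = \sum_(l < s) (1 - lam)^-1)%R.
  by rewrite sumr_const card_ord -[RHS]mulr_natl.
by apply: ler_sum => l _; rewrite -big_mkcond; apply: geometric_sum.
Qed.

(** Leftover, used and inner mass take at most 7/8 of |A| and the outer mass at most 1/8, yet
    together they must exceed |A|. *)
Lemma not_stuck : False.
Proof.
have := pieces_mass m u_gt0 kA.
rewrite pair_big_dep /= -/(isp _).
set total := \sum_(c | _) _ => mA.
have : total <= _ := mass_split.
clearbody total.
rewrite -(ler_nat rat) natrD natr_sum.
have sum_s (f : 'I_s -> nat) (b : rat) : (forall l, ((f l)%:R <= b)%R) ->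
    ((\sum_(l < s) f l)%:R <= s%:R * b)%R.
  move=> fb; rewrite natr_sum mulr_natl -[X in (b *+ X)%R](card_ord s) -sumr_const.
  exact: ler_sum.
have K_ge0 : (0 <= K)%R.
  by have := th_inv 0 0; rewrite expr0 mulr1; apply: le_trans; rewrite invr_ge0 ltW.
pose w : rat := ((kap u)%:R * 2 ^+ m)%R.
have w_ge0 : (0 <= w)%R by rewrite mulr_ge0 ?exprn_ge0.
have inner : (\sum_(i < n | (scale p <= i)%N) (\sum_(l < s) mass i l)%:R <=
    s%:R * (w * K) * 3 :> rat)%R.
  apply: le_trans (_ : (\sum_(i < n | (scale p <= i)%N)
      s%:R * (w * K) * (2 / 3) ^+ (i - scale p)%N <= _)%R).
    by apply: ler_sum => i pi; rewrite -mulrA; apply: sum_s => l; apply: mass_inner.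
  rewrite -mulr_sumr; apply: ler_wpM2l.
    exact: mulr_ge0 (ler0n _ _) (mulr_ge0 w_ge0 K_ge0).
  exact: geometric_sum_two_thirds.
have outer : (\sum_(i < n | ~~ (scale p <= i)%N) (\sum_(l < s) mass i l)%:R <=
    s%:R * (del * #|A|%:R) * (s%:R * (1 - lam)^-1) :> rat)%R.
  apply: le_trans (_ : (\sum_(i < n | (i < scale p)%N)
      s%:R * (del * #|A|%:R) * lam ^+ gap i <= _)%R).
    under eq_bigl => i do rewrite -ltnNge.
    apply: ler_sum => i ip; rewrite -mulrA; apply: sum_s => l.
    by rewrite mulrAC; apply: mass_outer.
  rewrite -mulr_sumr; apply: ler_wpM2l; last exact: gap_sum.
  exact: mulr_ge0 (ler0n _ _) (mulr_ge0 del_ge0 (ler0n _ _)).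
rewrite (bigID (fun i : 'I_n => (scale p <= i)%N)) /=.
move: mA; rewrite -(ltr_nat rat) natrD !natrM natrX -/w => mA le_total.
have two_ge1 : (1 <= 2 ^+ m :> rat)%R by rewrite exprn_ege1.
have small : (s%:R * (del * #|A|%:R) * (s%:R * (1 - lam)^-1) <= 8^-1 * #|A|%:R :> rat)%R.
  apply: le_trans (ler_wpM2r (ler0n _ #|A|) del_small).
  by rewrite le_eqVlt; apply/orP; left; apply/eqP; ring.
have growth : ((kap u)%:R * (kap u)%:R + w * (1 + 3 * s%:R * K) <= 7 / 8 * #|A|%:R :> rat)%R.
  rewrite cA natrM natrX mulrA.
  apply: le_trans (ler_wpM2r (exprn_ge0 m (ler0n _ 2)) (kap_growth u_gt0)).
  rewrite [leRHS]mulrDl; apply: lerD; first by rewrite ler_peMr // mulr_ge0.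
  by rewrite le_eqVlt /w; apply/orP; left; apply/eqP; ring.
suff : (#|A|%:R < #|A|%:R :> rat)%R by rewrite ltxx.
apply: lt_le_trans mA _; apply: le_trans (lerD le_total (lexx _)) _.
apply: le_trans (lerD (lerD (lexx _) (lerD inner (le_trans outer small))) (lexx _)) _.
by move: growth; rewrite (_ : w * _ = w + s%:R * (w * K) * 3)%R; [apply: budget|ring].
Qed.

End Stuck.

(** * Reading off the red cube *)

Hypothesis th_lt1 : forall k r, k < s.*2 -> (th k r < 1)%R.

Lemma red_cube :
  exists2 f : Q -> V, injective f & forall x i, ~~ blue (f x) (f (flip i x)).
Proof.
have [st [cst sp sat]] := saturated_exists.
have vst x : valid (st x) by case: cst => + _; apply.
have sz x : (size (st x)).+1 = s.
  apply/eqP; rewrite eqn_leq (valid_size (vst x)) /= leqNgt; apply/negP=> stuck.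
  exact: not_stuck cst sp sat stuck.
(* Depth s - 1 leaves clique parameter 1, so the piece is a singleton; its size 2^(n - scale) then
   forces scale n. *)
have single x : exists v, (piece (st x) == [set v]) && (scale (st x) == n).
  have [] := valid_piece (vst x) V_admissible.
  rewrite -{1 2}(sz x) subSnn kap1 mul1n => cA aA.
  have A0 : 0 < #|piece (st x)| by rewrite cA expn_gt0.
  have A1 : #|piece (st x)| <= 1.
    case/orP: aA => // /forallP free; case/card_gt0P: A0 => v vA.
    have := free [set v]; rewrite sub1set vA cards1 eqxx => /negP[].
    by apply/forall_inP=> a /set1P->; apply/forall_inP=> b /set1P->; rewrite eqxx.
  have /cards1P[v ->] : #|piece (st x)| == 1 by rewrite eqn_leq A1.
  exists v; rewrite eqxx eqn_leq valid_scale //= -subn_eq0.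
  by move: A1; rewrite cA -[1]/(2 ^ 0) leq_exp2l // leqn0.
have [f fP] := fin_all_exists single.
have f_piece x : piece (st x) = [set f x] by case/andP: (fP x) => /eqP.
have f_scale x : scale (st x) = n by case/andP: (fP x) => _ /eqP.
exists f => [x y fxy|x i].
  apply: agree_all; suff : agree (scale (st x)) x y by rewrite f_scale.
  have [_ /(_ x _ (suffix_refl _)) <-] := cst.
  suff -> : st x = st y by exact: suffix_refl.
  apply/eqP; apply/negPn/negP=> ne.
  have := valid_disjoint (vst x) (vst y) (succn_inj (etrans (sz x) (esym (sz y)))) ne.
  by rewrite !f_piece fxy disjoints1 inE eqxx.
have trunc_n y : trunc n (st y) = st y by rewrite trunc_id ?f_scale.
have := sp n (leqnn n) x i; rewrite /= !trunc_n !f_scale => /(_ (ltn_ord i) (ltn_ord i)).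
rewrite !f_piece /heavy !cards1 !mulr1 -leNgt /blue_edges !big_set1.
case: (blue _ _) => //; rewrite leNgt th_lt1 //.
by have := sz x; have := sz (flip i x); lia.
Qed.

End Pieces.

(** * Choice of the constants *)

(** Squaring pays for leftovers of order (kap u)^2. The value at 1 is dictated by [kap1]; the value
    at 0 is a positive default. *)
Fixpoint capacity M u := if u is u'.+1 then
  (if u' is 0 then 1 else M * (capacity M u' * capacity M u')) else 1.

Lemma capacity_gt0 M u : 0 < M -> 0 < capacity M u.
Proof.
by move=> M0; elim: u => [|[|u] IH] //; rewrite [capacity _ _]/= !muln_gt0 M0 /= -/(capacity _ u.+1) IH.
Qed.

Lemma capacity_rec M u : capacity M u.+2 = M * (capacity M u.+1 * capacity M u.+1).
Proof. by []. Qed.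

Section Threshold.

Variables (h : nat) (del lam : rat).
Hypotheses (del_gt0 : (0 < del)%R) (del_lt1 : (del < 1)%R).
Hypotheses (lam_gt0 : (0 < lam)%R) (lam_le1 : (lam <= 1)%R).
Hypothesis lam_h : (3 / 4 <= lam ^+ h)%R.

(** Geometric in k, reaching 1 at k = h; h will be 2 s, above any sum of two depths. *)
Definition threshold k r : rat := ((del * lam ^+ r) ^+ (h - k)%N)%R.

Let base_gt0 r : (0 < del * lam ^+ r)%R. Proof. by rewrite mulr_gt0 ?exprn_gt0. Qed.
Let base_lt1 r : (del * lam ^+ r < 1)%R.
Proof.
by apply: le_lt_trans del_lt1; rewrite ler_piMr ?(ltW del_gt0) // exprn_ile1 // ltW.
Qed.

Lemma threshold_gt0 k r : (0 < threshold k r)%R.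
Proof. by rewrite exprn_gt0. Qed.

Lemma threshold_lt1 k r : k < h -> (threshold k r < 1)%R.
Proof. by move=> kh; rewrite exprn_ilt1 ?(ltW (base_gt0 r)) // subn_eq0 -ltnNge. Qed.

Lemma threshold_step k r : k.+1 < h ->
  (threshold k r = del * lam ^+ r * threshold k.+1 r)%R.
Proof. by move=> kh; rewrite /threshold -exprS subnSK // ltnW. Qed.

(** At most h factors occur, and lam^h >= 3/4 bounds lam^(r h) below by (3/4)^r. *)
Lemma threshold_inv k r : ((threshold k r)^-1 <= del ^- h * (4 / 3) ^+ r)%R.
Proof.
have q_gt0 : (0 < 3 / 4 :> rat)%R by lra.
have -> : (del ^- h * (4 / 3) ^+ r = (del ^+ h * (3 / 4) ^+ r)^-1 :> rat)%R.
  by rewrite invfM -[((3 / 4) ^+ r)^-1%R]exprVn (_ : (3 / 4)^-1 = 4 / 3 :> rat)%R //; field.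
have low_gt0 : (0 < del ^+ h * (3 / 4) ^+ r)%R by apply: mulr_gt0; apply: exprn_gt0.
rewrite lef_pV2; [|exact: threshold_gt0|exact: low_gt0].
apply: le_trans (_ : ((del * lam ^+ r) ^+ h <= _)%R).
  rewrite [leRHS]exprMn; apply: ler_wpM2l; first exact/exprn_ge0/ltW.
  rewrite -[leRHS]exprM mulnC [leRHS]exprM.
  apply: lerXn2r lam_h; rewrite nnegrE; first exact: ltW q_gt0.
  exact/exprn_ge0/ltW.
by rewrite ler_wiXn2l ?leq_subr ?ltW.
Qed.

End Threshold.

(* del = 1 / (32 h s^2) with h = 2 s makes s^2 del / (1 - lam) = 1/8, where
   lam = 1 - 1 / (4 h) satisfies lam^h >= 3/4. *)
Definition inv_del s := 32 * s.*2 * (s * s).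
Definition lambda s : rat := (1 - (4 * s.*2%:R)^-1)%R.
(** The argument is 4 (1 + 3 s K) with K = del^(-2s), as [quadratic_growth] requires. *)
Definition cube_constant s := capacity (4 * (1 + 3 * s * inv_del s ^ s.*2)).

Section Constants.

Variable s : nat.
Hypothesis s_gt0 : 0 < s.

Let lam := lambda s.
Let del : rat := ((inv_del s)%:R^-1)%R.

Let double_s : (1 <= s.*2%:R :> rat)%R. Proof. by rewrite ler1n double_gt0. Qed.

Lemma inv_del_gt1 : 1 < inv_del s.
Proof. by rewrite /inv_del; case: s s_gt0 => // t _; rewrite -mul2n; lia. Qed.

Let step_gt0 : (0 < (4 * s.*2%:R)^-1 :> rat)%R.
Proof. by rewrite invr_gt0; move: double_s; lra. Qed.

Let step_le : ((4 * s.*2%:R)^-1 <= 4^-1 :> rat)%R.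
Proof.
have H4 : (4 <= 4 * s.*2%:R :> rat)%R by move: double_s; lra.
by rewrite lef_pV2 // posrE; apply: lt_le_trans H4.
Qed.

Lemma lambda_gt0 : (0 < lambda s)%R.
Proof. by rewrite /lambda; move: step_le; lra. Qed.

Lemma lambda_lt1 : (lambda s < 1)%R.
Proof. by rewrite /lambda; move: step_gt0; lra. Qed.

Lemma lambda_pow : (3 / 4 <= lambda s ^+ s.*2)%R.
Proof.
apply: le_trans (bernoulli s.*2 (ltW step_gt0) _); last by move: step_le; lra.
have H0 : (s.*2%:R != 0 :> rat)%R by rewrite pnatr_eq0 -lt0n double_gt0.
have -> : (s.*2%:R * (4 * s.*2%:R)^-1 = 4^-1 :> rat)%R by field.
by lra.
Qed.

Lemma del_gt0 : (0 < del)%R.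
Proof. by rewrite invr_gt0 ltr0n ltnW ?inv_del_gt1. Qed.

Lemma del_lt1 : (del < 1)%R.
Proof. by rewrite /del invf_lt1 ?ltr1n ?ltr0n ?inv_del_gt1 // ltnW ?inv_del_gt1. Qed.

Lemma del_small : (s%:R * s%:R * del * (1 - lam)^-1 <= 8^-1)%R.
Proof.
have s0 : (s%:R != 0 :> rat)%R by rewrite pnatr_eq0 -lt0n.
have H0 : (s.*2%:R != 0 :> rat)%R by rewrite pnatr_eq0 -lt0n double_gt0.
rewrite le_eqVlt /del /lam /inv_del /lambda !natrM; apply/orP; left; apply/eqP.
rewrite opprB addrC subrK; move: (s.*2%:R)%R H0 (s%:R)%R s0 => a a0 b b0.
by field; rewrite a0 b0.
Qed.

Lemma cube_constant_gt0 u : 0 < cube_constant s u.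
Proof. by rewrite capacity_gt0 ?muln_gt0. Qed.

Lemma cube_constant_growth u : 0 < u ->
  ((cube_constant s u)%:R * (cube_constant s u)%:R +
     (cube_constant s u)%:R * (1 + 3 * s%:R * del ^- s.*2)
   <= 7 / 8 * (cube_constant s u.+1)%:R :> rat)%R.
Proof.
move=> u_gt0; rewrite -(prednK u_gt0); have := cube_constant_gt0 u.-1.+1.
rewrite /cube_constant capacity_rec; move: (capacity _ u.-1.+1) => c.
rewrite -(ler1n rat) => c1; rewrite !natrM natrD !natrM natrX /del -exprVn invrK.
rewrite -[(3 * _ * _)%R]mulrA.
have : (0 <= s%:R * (inv_del s)%:R ^+ s.*2 :> rat)%R by apply: mulr_ge0; [|apply: exprn_ge0].
move: (s%:R * _)%R (c%:R)%R c1; exact: quadratic_growth.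
Qed.

End Constants.

(** * The Ramsey bound *)

Lemma ramsey_cube_clique s n : 0 < s ->
  ramsey_prop (cube_adj n) (complete_adj s) (cube_constant s s * 2 ^ n).
Proof.
move=> s_gt0 red red_sym.
pose blue : rel 'I_(cube_constant s s * 2 ^ n) := fun a b => (a != b) && ~~ red a b.
case: (boolP (clique_free blue s setT)) => [free|/forallPn[C]]; last first.
  rewrite negb_imply negbK => /andP[/andP[_ /eqP cC] /forall_inP bC].
  right; exists (fun i : 'I_s => enum_val (cast_ord (esym cC) i)); split.
    by move=> i j /enum_val_inj /cast_ord_inj.
  move=> i j ij; have /forall_inP := bC _ (enum_valP (cast_ord (esym cC) i)).
  move/(_ _ (enum_valP (cast_ord (esym cC) j)))/implyP.
  rewrite (inj_eq enum_val_inj) (inj_eq (@cast_ord_inj _ _ _)) => /(_ ij).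
  by case/andP.
have blue_sym : symmetric blue by move=> a b; rewrite /blue eq_sym red_sym.
have blue_irr : irreflexive blue by move=> a; rewrite /blue eqxx.
have d0 := del_gt0 s_gt0; have d1 := del_lt1 s_gt0.
have l0 := lambda_gt0 s_gt0; have l1 := lambda_lt1 s_gt0.
have [f f_inj f_red] := red_cube blue_sym blue_irr (cube_constant_gt0 s) (erefl _) s_gt0
  (card_ord _) (ltW l0) l1 (threshold_gt0 _ d0 l0)
  (threshold_inv d0 d1 l0 (ltW l1) (lambda_pow s_gt0)) (threshold_step _ _)
  (ltW d0) (del_small s_gt0) (cube_constant_growth s) (introT orP (or_intror free))
  (threshold_lt1 d0 d1 l0 (ltW l1)).
left; exists f; split=> // x y /adjacent_flip[i ->].
have := f_red x i; rewrite /blue negb_and negbK (inj_eq f_inj) => /orP[/eqP xx|].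
  by have := congr1 (fun z : cube_vert n => z i) xx; rewrite ffunE eqxx; case: (x i).
by rewrite negbK.
Qed.

Theorem theorem1 :
  forall s : nat, 3 <= s ->
  exists c : nat, forall n : nat,
    exists r : nat, is_ramsey_number (cube_adj n) (complete_adj s) r /\
                    r <= c * 2 ^ n.
Proof.
move=> s s3; exists (cube_constant s s) => n.
have := @ramsey_cube_clique s n (ltnW (ltnW s3)).
(* Descent from the bound to the least N with the Ramsey property, deciding by excluded middle
   whether a smaller one exists. *)
elim/ltn_ind: (_ * _) => N IH ramN.
case: (classic (exists2 k, k < N & ramsey_prop (cube_adj n) (complete_adj s) k)).
  by case=> k kN /(IH k kN)[r [ram_r rk]]; exists r; split=> //; apply: leq_trans rk (ltnW kN).
move=> minN; exists N; split=> //; split=> // k ramk.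
by rewrite leqNgt; apply/negP=> kN; apply: minN; exists k.
Qed.
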